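(* Let the GNR-surface $F_{(\alpha,q_n)}$ be developable and let $\vec v_p$ be a unit tangent vector of $F_{(\alpha,q_n)}$ at a regular point $p=(s,u)$. (i) If $\kappa\neq0$, then $\vec v_p$ is asymptotic if and only if $\vec v_p$ is a ruling, i.e. $\vec v_p=\pm\vec q_n(s)$, or $a_2(s)=0$. (ii) If $\alpha$ is a straight line, then any tangent vector $\vec v_p$ is asymptotic.
   Context: Let $I\subset\mathbb{R}$ be an open interval and $\alpha:I\to\mathbb{R}^3$ a smooth unit speed curve with arclength parameter $s$, positively oriented orthonormal Frenet frame $\{\vec T,\vec N,\vec B\}$, curvature $\kappa$ and torsion $\tau$: $\vec T=\vec\alpha'$, $\vec T'=\kappa\vec N$, $\vec N'=-\kappa\vec T+\tau\vec B$, $\vec B'=-\tau\vec N$ (prime is $d/ds$). Convention: either $\kappa>0$ on $I$, or $\alpha$ is a straight line, in which case $\kappa=\tau=0$ and $\vec N,\vec B$ are chosen constant. Let $a_1,a_2:I\to\mathbb{R}$ be smooth with $a_1^2+a_2^2=1$. The generalized normal ruled surface (GNR-surface) of $\alpha$ is $\vec F_{(\alpha,q_n)}(s,u)=\vec\alpha(s)+u\,\vec q_n(s)$, $(s,u)\in I\times\mathbb{R}$, with $\vec q_n=a_1\vec N+a_2\vec B$. It is developable if $\det(\vec\alpha',\vec q_n,\vec q_n')=0$ for all $s$. A point $(s,u)$ is regular if $\frac{\partial\vec F}{\partial s}\times\frac{\partial\vec F}{\partial u}\neq0$ there. A unit tangent vector $\vec v_p$ is asymptotic if the normal curvature $k_n(\vec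 v_p)=\langle S_p(\vec v_p),\vec v_p\rangle$ is zero, where $S_p$ is the Weingarten map (shape operator) at $p$. *)

(* Defs.v *)
From HB Require Import structures.
From mathcomp Require Export all_boot all_order all_algebra.
From mathcomp Require Export all_classical all_reals all_analysis.

Set Implicit Arguments.
Unset Strict Implicit.
Unset Printing Implicit Defensive.

Export Order.TTheory GRing.Theory Num.Theory.
Export numFieldNormedType.Exports.

Local Open Scope ring_scope.
Local Open Scope classical_set_scope.

(** * Euclidean 3-space *)

(* The norm [`|_|] of ['rV[R]_3] in the library is the sup norm, so the
   Euclidean structure is given separately. *)
Definition dot {R : realType} (v w : 'rV[R]_3) : R := (v *m w^T) 0 0.

Definition enorm {R : realType} (v : 'rV[R]_3) : R := Num.sqrt (dot v v).

Definition rows3 {R : realType} (v w z : 'rV[R]_3) : 'M[R]_3 :=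
  \matrix_(i < 3) nth 0 [:: v; w; z] i.

(* The indices are in ['I_3], hence are added modulo 3. *)
Definition cross {R : realType} (v w : 'rV[R]_3) : 'rV[R]_3 :=
  \row_(i < 3) (v 0 (i + 1) * w 0 (i + 2%:R) - v 0 (i + 2%:R) * w 0 (i + 1)).

(** * Curves *)

(* Meant for an open set [I]: [f] is a total function of which only the values
   on [I] matter. *)
Definition smooth_on {R : realType} {V : normedModType R} (I : set R)
    (f : R -> V) : Prop :=
  forall (n : nat) (s : R), I s -> derivable (derive1n n f) s 1.

Definition constant_on {R : realType} {V : Type} (I : set R) (f : R -> V)
    : Prop :=
  exists c : V, forall s, I s -> f s = c.

Definition straight_line {R : realType} (I : set R) (alpha : R -> 'rV[R]_3)
    : Prop :=
  exists p d : 'rV[R]_3, forall s, I s -> alpha s = p + s *: d.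

Record frenet_curve {R : realType} (I : set R) (alpha T N B : R -> 'rV[R]_3)
    (kappa tau : R -> R) : Prop := FrenetCurve {
  frenet_smooth : smooth_on I alpha;
  frenet_unit_speed : forall s, I s -> enorm (derive1 alpha s) = 1;
  frenet_tangent : forall s, I s -> T s = derive1 alpha s;
  frenet_orthonormal : forall s, I s ->
    rows3 (T s) (N s) (B s) *m (rows3 (T s) (N s) (B s))^T = 1%:M;
  frenet_oriented : forall s, I s -> 0 < \det (rows3 (T s) (N s) (B s));
  frenet_dT : forall s, I s -> is_derive s 1 T (kappa s *: N s);
  frenet_dN : forall s, I s ->
    is_derive s 1 N (- kappa s *: T s + tau s *: B s);
  frenet_dB : forall s, I s -> is_derive s 1 B (- tau s *: N s);
  frenet_convention :
    (forall s, I s -> 0 < kappa s) \/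
    [/\ straight_line I alpha,
        forall s, I s -> kappa s = 0,
        forall s, I s -> tau s = 0,
        constant_on I N & constant_on I B] }.

(** * Parametrized surfaces *)

Section Surface.
Context {R : realType}.
Implicit Types (F : R * R -> 'rV[R]_3) (p : R * R) (v : 'rV[R]_3).

Definition partial_s F p : 'rV[R]_3 := 'D_((1, 0) : R * R) F p.

Definition partial_u F p : 'rV[R]_3 := 'D_((0, 1) : R * R) F p.

Definition regular_point F p : Prop := cross (partial_s F p) (partial_u F p) != 0.

Definition unit_normal F p : 'rV[R]_3 :=
  let n := cross (partial_s F p) (partial_u F p) in (enorm n)^-1 *: n.

Definition tangent_vector F p v : Prop := exists w : R * R, 'd F p w = v.

(* S_p(v) = - D_v U for the unit normal field U, that is [- 'd U p w] for the
   vector [w] of the parameter plane with ['d F p w = v]; [w] is unique when [p]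
   is regular. *)
Definition weingarten F p v : 'rV[R]_3 :=
  - 'd (unit_normal F) p (get [set w : R * R | 'd F p w = v]).

Definition normal_curvature F p v : R := dot (weingarten F p v) v.

(* For a unit tangent vector [v]. *)
Definition asymptotic F p v : Prop := normal_curvature F p v = 0.

End Surface.

(** * Generalized normal ruled surfaces *)

Section GNR.
Context {R : realType}.

Definition gnr_direction (N B : R -> 'rV[R]_3) (a1 a2 : R -> R)
    : R -> 'rV[R]_3 :=
  fun s => a1 s *: N s + a2 s *: B s.

Definition ruled_surface (alpha q : R -> 'rV[R]_3) : R * R -> 'rV[R]_3 :=
  fun p => alpha p.1 + p.2 *: q p.1.

Definition developable (I : set R) (alpha q : R -> 'rV[R]_3) : Prop :=
  forall s, I s -> \det (rows3 (derive1 alpha s) (q s) (derive1 q s)) = 0.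

End GNR.

(* Main.v *)
From HB Require Import structures.
Require Import Defs.
From mathcomp Require Import ring.

Set Implicit Arguments.
Unset Strict Implicit.
Unset Printing Implicit Defensive.

Local Open Scope ring_scope.
Local Open Scope classical_set_scope.

(** The whole second fundamental form of a developable generalized normal ruled
    surface sits in the single coefficient [kappa a2].

    Write [q = a1 N + a2 B].  By the Frenet equations,
    [q' = - kappa a1 T + (a1' - a2 tau) N + (a2' + a1 tau) B].  The [N,B]-part
    of [q'] is orthogonal to [q] because [a1^2 + a2^2 = 1], and orthogonal to
    [T x q = a1 B - a2 N] because [det (T, q, q') = 0]; hence it vanishes, that
    is [a1' = a2 tau] and [a2' = - a1 tau] ([gnr_derive_coeffs]).  So
    [q' = - kappa a1 T], and in the same way [(T x q)' = kappa a2 T]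
    ([gnr_derive], [gnr_normal_derive]).

    Consequently [F_s = c T] with [c = 1 - u kappa a1], and [F_u = q].  A point
    is regular when [c != 0], and then the unit normal is [sgn c] times [T x q].
    The sign of [c] is locally constant, so the unit normal is constant along
    the rulings and its differential sends [(x, y)] to [sgn c x kappa a2 T].
    Since [<T, dF (x, y)> = x c], the normal curvature of [v] is
    [- kappa a2 / |c| <T, v>^2] ([normal_curvature_ruled],
    [gnr_normal_curvature]).

    If [kappa != 0] this vanishes exactly when [a2 = 0] or [v] is orthogonal to
    [T]; as [v] is a unit vector of the plane spanned by [T] and [q], the latter
    means [v = q] or [v = - q].  On a straight line [T] is constant, so
    [kappa N = T' = 0] and the normal curvature is zero.

    The point that needs care is that the sign of [c] is constant only if
    [kappa] is continuous.  This is obtained from [kappa = <alpha'', N>]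
    ([frenet_curvature_continuous]). *)

(** * Euclidean algebra in coordinates *)

Section Euclidean.
Context {R : realType}.
Implicit Types (u v w : 'rV[R]_3) (k : R).

Lemma sum3 (f : 'I_3 -> R) : \sum_(i < 3) f i = f 0 + f 1 + f 2%:R.
Proof.
rewrite !big_ord_recr big_ord0 /= add0r.
by congr (_ + _ + _); congr f; apply: val_inj.
Qed.

Lemma dotE v w :
  dot v w = v 0 0 * w 0 0 + v 0 1 * w 0 1 + v 0 2%:R * w 0 2%:R.
Proof. by rewrite /dot mxE sum3 !mxE. Qed.

Lemma row3P v w :
  v 0 0 = w 0 0 -> v 0 1 = w 0 1 -> v 0 2%:R = w 0 2%:R -> v = w.
Proof.
move=> e0 e1 e2; apply/rowP => i.
case: i => -[|[|[|//]]] hi.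
- by move: e0; congr (_ = _); congr (fun_of_matrix _ _ _); apply: val_inj.
- by move: e1; congr (_ = _); congr (fun_of_matrix _ _ _); apply: val_inj.
- by move: e2; congr (_ = _); congr (fun_of_matrix _ _ _); apply: val_inj.
Qed.

Lemma cross0E v w : cross v w 0 0 = v 0 1 * w 0 2%:R - v 0 2%:R * w 0 1.
Proof. by rewrite mxE !add0r. Qed.

Lemma cross1E v w : cross v w 0 1 = v 0 2%:R * w 0 0 - v 0 0 * w 0 2%:R.
Proof.
have -> : (0 : 'I_3) = 1 + 2%:R by apply: val_inj.
by rewrite mxE; have -> : (2%:R : 'I_3) = 1 + 1 by apply: val_inj.
Qed.

Lemma cross2E v w : cross v w 0 2%:R = v 0 0 * w 0 1 - v 0 1 * w 0 0.
Proof.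
rewrite mxE.
have -> : (2%:R + 1 : 'I_3) = 0 by apply: val_inj.
by have -> : (2%:R + 2%:R : 'I_3) = 1 by apply: val_inj.
Qed.

Definition crossE := (cross0E, cross1E, cross2E).

Lemma det2E (A : 'M[R]_2) : \det A = A 0 0 * A 1 1 - A 0 1 * A 1 0.
Proof.
rewrite (expand_det_row _ 0) !big_ord_recl big_ord0 addr0 /cofactor.
rewrite !det_mx11 !mxE.
have -> : lift 0 0 = 1 :> 'I_2 by apply: val_inj.
have -> : lift 1 0 = 0 :> 'I_2 by apply: val_inj.
by rewrite /= expr0 expr1 mul1r mulN1r mulrN.
Qed.

Lemma det_rows3 u v w : \det (rows3 u v w) = dot (cross u v) w.
Proof.
rewrite (expand_det_row _ 0) sum3 /cofactor !det2E dotE !crossE !mxE.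
have e00 : lift 0 0 = 1 :> 'I_3 by apply: val_inj.
have e01 : lift 0 1 = 2%:R :> 'I_3 by apply: val_inj.
have e10 : lift 1 0 = 0 :> 'I_3 by apply: val_inj.
have e11 : lift 1 1 = 2%:R :> 'I_3 by apply: val_inj.
have e20 : lift 2%:R 0 = 0 :> 'I_3 by apply: val_inj.
have e21 : lift 2%:R 1 = 1 :> 'I_3 by apply: val_inj.
rewrite e00 e01 e10 e11 e20 e21 /=.
rewrite (_ : (-1) ^+ (0 + (2%:R : 'I_3)) = 1) ?expr0 ?expr1 ?sqrrN ?expr1n //.
ring.
Qed.

Lemma dotC v w : dot v w = dot w v.
Proof. by rewrite !dotE; ring. Qed.

Lemma dotDl u v w : dot (u + v) w = dot u w + dot v w.
Proof. by rewrite /dot mulmxDl mxE. Qed.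

Lemma dotZl k v w : dot (k *: v) w = k * dot v w.
Proof. by rewrite /dot -scalemxAl mxE. Qed.

Lemma dotNl v w : dot (- v) w = - dot v w.
Proof. by rewrite -scaleN1r dotZl mulN1r. Qed.

Lemma dotDr u v w : dot u (v + w) = dot u v + dot u w.
Proof. by rewrite dotC dotDl !(dotC u). Qed.

Lemma dotZr k v w : dot v (k *: w) = k * dot v w.
Proof. by rewrite dotC dotZl dotC. Qed.

Definition dot_linear := (dotDl, dotZl, dotNl, dotDr, dotZr).

Lemma crossDr u v w : cross u (v + w) = cross u v + cross u w.
Proof. by apply: row3P; rewrite !mxE; ring. Qed.

Lemma crossZl k v w : cross (k *: v) w = k *: cross v w.
Proof. by apply: row3P; rewrite !mxE; ring. Qed.

Lemma crossZr k v w : cross v (k *: w) = k *: cross v w.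
Proof. by apply: row3P; rewrite !mxE; ring. Qed.

Lemma enormZ k v : enorm (k *: v) = `|k| * enorm v.
Proof.
by rewrite /enorm !dot_linear mulrA -expr2 sqrtrM ?sqr_ge0 // sqrtr_sqr.
Qed.

(** Lagrange's identity; it shows that [cross v w] is a unit vector when [v] and
    [w] are orthonormal. *)
Lemma dot_cross_cross v w :
  dot (cross v w) (cross v w) = dot v v * dot w w - dot v w ^+ 2.
Proof. by rewrite !dotE !crossE; ring. Qed.

Lemma rows3_gram u v w :
  rows3 u v w *m (rows3 u v w)^T = rows3
    (\row_i nth 0 [:: dot u u; dot u v; dot u w] i)
    (\row_i nth 0 [:: dot v u; dot v v; dot v w] i)
    (\row_i nth 0 [:: dot w u; dot w v; dot w w] i).
Proof.
apply/matrixP => i j; rewrite !mxE.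
by case: i => -[|[|[|//]]] hi; case: j => -[|[|[|//]]] hj;
  rewrite /= !mxE /= /dot mxE; apply: eq_bigr => k _; rewrite !mxE.
Qed.

(** Orthonormality forces [det^2 = 1], so a positive determinant is 1.  The
    cross products are then read off from their coordinates in the basis, which
    are triple products. *)
Lemma oriented_frame (t n b : 'rV[R]_3) (M := rows3 t n b) :
  M *m M^T = 1%:M -> 0 < \det M ->
  [/\ [/\ dot t t = 1, dot n n = 1 & dot b b = 1],
    [/\ dot t n = 0, dot t b = 0 & dot n b = 0],
    cross t n = b & cross t b = - n].
Proof.
move=> hM dM.
have hE i j : (M *m M^T) i j = (1%:M : 'M[R]_3) i j by rewrite hM.
have htt := hE 0 0; have hnn := hE 1 1; have hbb := hE 2%:R 2%:R.
have htn := hE 0 1; have htb := hE 0 2%:R; have hnb := hE 1 2%:R.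
rewrite /M rows3_gram !mxE /= in htt hnn hbb htn htb hnb.
have detM : dot (cross t n) b = 1.
  rewrite -det_rows3 -/M; apply/eqP; rewrite -(@pexpr_eq1 _ _ 2) ?ltW //.
  by rewrite expr2 -{2}det_tr -det_mulmx hM det1.
have basis v : v = dot v t *: t + dot v n *: n + dot v b *: b.
  rewrite -[LHS]mulmx1 -(mulmx1C hM) mulmxA.
  by apply: row3P; rewrite !mxE !sum3 !mxE !sum3 !mxE /= !dotE; ring.
split => //.
  rewrite [LHS]basis detM.
  have -> : dot (cross t n) t = 0 by rewrite dotE !crossE; ring.
  have -> : dot (cross t n) n = 0 by rewrite dotE !crossE; ring.
  by rewrite !scale0r !add0r scale1r.
rewrite [LHS]basis.
have -> : dot (cross t b) t = 0 by rewrite dotE !crossE; ring.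
have -> : dot (cross t b) b = 0 by rewrite dotE !crossE; ring.
have -> : dot (cross t b) n = -1 by rewrite -detM !dotE !crossE; ring.
by rewrite !scale0r add0r addr0 scaleN1r.
Qed.

Lemma cvg_dot (X : Type) (F : set_system X) {FF : Filter F}
    (f g : X -> 'rV[R]_3) (a b : 'rV[R]_3) :
  f @ F --> a -> g @ F --> b -> (fun x => dot (f x) (g x)) @ F --> dot a b.
Proof.
have coord (h : X -> 'rV[R]_3) (c : 'rV[R]_3) i :
    h @ F --> c -> (fun x => h x 0 i) @ F --> c 0 i.
  by move=> hc; exact: (cvg_comp _ _ hc (@coord_continuous _ _ _ _ _ _)).
move=> fa gb.
have -> : (fun x => dot (f x) (g x)) = fun x =>
    f x 0 0 * g x 0 0 + f x 0 1 * g x 0 1 + f x 0 2%:R * g x 0 2%:R.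
  by apply/funext => x; rewrite dotE.
by rewrite dotE; apply: cvgD; first apply: cvgD; apply: cvgM; apply: coord.
Qed.

End Euclidean.

(** * Differentials *)

Section Differential.
Context {R : realType} {V W : normedModType R}.

Lemma scale_is_bilinear :
  bilinear_for
    (GRing.Scale.Law.clone _ _ *:%R _) (GRing.Scale.Law.clone _ _ *:%R _)
    (@GRing.scale R W : R^o -> W -> W).
Proof.
split=> [u'|u] a x y /=.
- by rewrite scalerDl scalerA.
- by rewrite scalerDr !scalerA mulrC.
Qed.

HB.instance Definition _ := bilinear_isBilinear.Build R R^o W W _ _
  (@GRing.scale R W : R^o -> W -> W) scale_is_bilinear.

Lemma is_diff_scale (p : R * W) :
  is_diff p (fun q : R * W => q.1 *: q.2)
            (fun h : R * W => p.1 *: h.2 + h.1 *: p.2).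
Proof.
have fc : continuous (fun q : R^o * W => q.1 *: q.2).
  exact: scale_continuous.
apply: DiffDef.
  exact: (@differentiable_bilin R R^o W W (@GRing.scale R W) p fc).
exact: (@diff_bilin R R^o W W (@GRing.scale R W) p fc).
Qed.

Lemma is_diff_scalef (k dk : V -> R) (f df : V -> W) x :
  is_diff x k dk -> is_diff x f df ->
  is_diff x (fun y => k y *: f y) (fun h => k x *: df h + dk h *: f x).
Proof.
move=> kx fx; have sx := is_diff_scale (k x, f x).
have -> : (fun y => k y *: f y) =
  (fun q : R * W => q.1 *: q.2) \o (fun y => (k y, f y)) by [].
exact: is_diff_eq.
Qed.

Lemma is_derive_diff (f : R -> W) (df : W) (x : R) :
  is_derive x 1 f df <-> is_diff x f (fun h => h *: df).
Proof.
split=> [[fx <-]|[fx dfx]].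
  by apply: DiffDef; [exact/derivable1_diffP | rewrite deriv1E // derive1E].
by apply: DeriveDef; [exact/derivable1_diffP | rewrite deriveE // dfx scale1r].
Qed.

(** The differential is local: the unit normal of a surface is only known in a
    neighbourhood of the point at which it has to be differentiated. *)
Lemma near_eq_is_diff (f g df : V -> W) x :
  (\near x, f x = g x) -> is_diff x f df -> is_diff x g df.
Proof.
move=> fg [fx dfx].
have gE : g \o shift x = cst (g x) + 'd f x +o_ 0 id.
  apply/eqaddoP => e e0.
  have := diff_locally fx => /eqaddoP /(_ e e0).
  rewrite /= !near_simpl -(nbhs_singleton fg).
  have : \forall y \near 0, f (y + x) = g (y + x).
    by move: fg; rewrite (near_shift 0 x) subr0; exact.
  apply: filterS2 => y fgy.
  (* rewrites of pointwise sums of functions as sums in the function space *)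
  by rewrite -![(_ + _ : _ -> _) _]/(_ + _) -![(- _ : _ -> _) _]/(- _) /= fgy.
have dg : 'd g x = 'd f x :> (V -> W).
  by apply: diff_unique => //; exact: diff_continuous.
split; last by rewrite dg.
by apply/diff_locallyP; rewrite dg; split => //; exact: diff_continuous.
Qed.

End Differential.

Section Curves.
Context {R : realType} {V W : normedModType R}.

Lemma is_derive_scalef (k : R -> R) (f : R -> W) (dk : R) (df : W) (x : R) :
  is_derive x 1 k dk -> is_derive x 1 f df ->
  is_derive x 1 (fun y => k y *: f y) (k x *: df + dk *: f x).
Proof.
move=> kx /is_derive_diff fx.
have kx' : is_diff x k (fun h => h * dk) by exact/is_derive_diff.
apply/is_derive_diff; apply: is_diff_eq; first exact: is_diff_scalef kx' fx.
by apply/funext => h; rewrite scalerDr !scalerA mulrC.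
Qed.

Lemma is_diff_snd (p : V * W) :
  is_diff p (snd : V * W -> W) (snd : V * W -> W).
Proof.
have sndc : continuous (snd : V * W -> W) by move=> x; exact: cvg_snd.
by apply: DiffDef; [exact: linear_differentiable | rewrite diff_lin].
Qed.

Lemma is_diff_curve_fst (f : R -> W) (df : W) (x : R) (y : V) :
  is_derive x 1 f df ->
  is_diff (x, y) (f \o fst) ((fun h => h *: df) \o (fst : R * V -> R)).
Proof.
move=> /is_derive_diff Df.
have Dfst : is_diff (x, y) (fst : R * V -> R) (fst : R * V -> R).
  have fstc : continuous (fst : R * V -> R) by move=> z; exact: cvg_fst.
  by apply: DiffDef; [exact: linear_differentiable | rewrite diff_lin].
exact: is_diff_comp.
Qed.

Lemma is_derive_smooth (I : set R) (f : R -> V) t :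
  smooth_on I f -> I t -> is_derive t 1 f (derive1 f t).
Proof.
by move=> sf It; rewrite derive1E; apply/derivableP; exact: (sf 0%N).
Qed.

End Curves.

(** * Ruled surfaces *)

Section RuledSurface.
Context {R : realType}.
Variables (alpha q : R -> 'rV[R]_3) (da dq : 'rV[R]_3) (s u : R).
Hypothesis Dalpha : is_derive s 1 alpha da.
Hypothesis Dq : is_derive s 1 q dq.

Lemma is_diff_ruled_surface :
  is_diff (s, u) (ruled_surface alpha q)
    (fun w : R * R => w.1 *: (da + u *: dq) + w.2 *: q s).
Proof.
have D := is_diffD (is_diff_curve_fst u Dalpha)
  (is_diff_scalef (is_diff_snd (s, u)) (is_diff_curve_fst u Dq)).
apply: (is_diff_eq D).
by apply/funext => w; rewrite fctE /= scalerDr !scalerA (mulrC u) addrA.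
Qed.

Lemma diff_ruled_surface (w : R * R) :
  'd (ruled_surface alpha q) (s, u) w = w.1 *: (da + u *: dq) + w.2 *: q s.
Proof.
exact: (congr1 (fun f : R * R -> 'rV[R]_3 => f w)
  (@diff_val _ _ _ _ _ _ _ is_diff_ruled_surface)).
Qed.

Lemma partial_ruled_surface :
  partial_s (ruled_surface alpha q) (s, u) = da + u *: dq /\
  partial_u (ruled_surface alpha q) (s, u) = q s.
Proof.
have D := is_diff_ruled_surface.
rewrite /partial_s /partial_u !deriveE // !diff_val /=.
by rewrite !scale1r !scale0r addr0 add0r.
Qed.

End RuledSurface.

Lemma ruled_surface_regular (R : realType) (alpha q : R -> 'rV[R]_3)
    (T : 'rV[R]_3) (lam s u : R) :
  is_derive s 1 alpha T -> is_derive s 1 q (lam *: T) ->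
  regular_point (ruled_surface alpha q) (s, u) -> 1 + u * lam != 0.
Proof.
move=> Da Dq; rewrite /regular_point.
have [-> ->] := partial_ruled_surface u Da Dq.
apply: contra_neq => c0.
rewrite scalerA -[X in X + _]scale1r -scalerDl c0 scale0r.
by apply: row3P; rewrite !mxE; ring.
Qed.

(** The surfaces considered here are those whose tangent plane is constant
    along each ruling: [q'] is parallel to [alpha' = T], with [(T, q)]
    orthonormal. *)
Section TangentRuledSurface.
Context {R : realType}.
Variables (alpha q T : R -> 'rV[R]_3) (lam : R -> R) (s u : R).
Let F := ruled_surface alpha q.
Hypothesis dalpha : \forall t \near s, is_derive (t : R) 1 alpha (T t).
Hypothesis dq : \forall t \near s, is_derive (t : R) 1 q (lam t *: T t).
Hypothesis TT : \forall t \near s, dot (T t) (T t) = 1.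
Hypothesis qq : \forall t \near s, dot (q t) (q t) = 1.
Hypothesis Tq : \forall t \near s, dot (T t) (q t) = 0.
Hypothesis lam_cont : {for s, continuous lam}.

(** Here [F_s x F_u] is [(1 + u lam) *: cross T q], so normalizing leaves the
    sign of [1 + u lam], which is constant near a regular point because [lam] is
    continuous. *)
Lemma unit_normal_ruled : 1 + u * lam s != 0 ->
  \forall p \near (s, u),
    unit_normal F p = Num.sg (1 + u * lam s) *: cross (T p.1) (q p.1).
Proof.
move=> c0.
have fst1 : (fun p : R * R => p.1) @ (s, u) --> s by exact: cvg_fst.
have cc : (fun p : R * R => 1 + p.2 * lam p.1) @ (s, u) --> 1 + u * lam s.
  apply: cvgD; first exact: cvg_cst.
  apply: cvgM; first exact: cvg_snd.
  by apply: cvg_comp fst1 _; exact: lam_cont.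
have sgn : \forall p \near (s, u),
    Num.sg (1 + p.2 * lam p.1) = Num.sg (1 + u * lam s).
  move: c0; rewrite neq_lt => /orP[c0|c0].
    near=> p; rewrite !ltr0_sg //; near: p.
    exact: (cvgr_lt _ cc).
  near=> p; rewrite !gtr0_sg //; near: p.
  exact: (cvgr_gt _ cc).
have nearfst (P : R -> Prop) :
    (\forall t \near s, P t) -> \forall p \near (s, u), P p.1.
  by move=> ?; exact: fst1.
near=> p.
have E : 1 + p.2 * lam p.1 =
    Num.sg (1 + u * lam s) * `|1 + p.2 * lam p.1|.
  by rewrite [LHS]numEsg; congr (_ * _); near: p; exact: sgn.
have Da : is_derive p.1 1 alpha (T p.1) by near: p; exact: (nearfst _ dalpha).
have Dq : is_derive p.1 1 q (lam p.1 *: T p.1).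
  by near: p; exact: (nearfst _ dq).
have TTp : dot (T p.1) (T p.1) = 1 by near: p; exact: (nearfst _ TT).
have qqp : dot (q p.1) (q p.1) = 1 by near: p; exact: (nearfst _ qq).
have Tqp : dot (T p.1) (q p.1) = 0 by near: p; exact: (nearfst _ Tq).
have c1 : `|1 + p.2 * lam p.1| != 0.
  have : Num.sg (1 + p.2 * lam p.1) = Num.sg (1 + u * lam s).
    by near: p; exact: sgn.
  by rewrite normr_eq0 -sgr_eq0 => ->; rewrite sgr_eq0.
rewrite /unit_normal.
have [] := partial_ruled_surface p.2 Da Dq.
rewrite -surjective_pairing => -> ->.
rewrite scalerA -[X in X + _]scale1r -scalerDl crossZl enormZ.
rewrite /enorm dot_cross_cross TTp qqp Tqp expr0n subr0 mulr1 sqrtr1 mulr1.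
rewrite scalerA; congr (_ *: _); apply: (mulfI c1).
by rewrite mulVKf //; exact: (etrans E (mulrC _ _)).
Unshelve. all: by end_near. Qed.

(** For [v = 'd F w] one has [dot T v = w.1 * (1 + u lam)], so the right-hand
    side depends on [v] alone, whichever preimage [w] the shape operator
    picks. *)
Lemma normal_curvature_ruled (mu : R) (v : 'rV[R]_3) :
  is_derive s 1 (fun t => cross (T t) (q t)) (mu *: T s) ->
  regular_point F (s, u) -> tangent_vector F (s, u) v ->
  normal_curvature F (s, u) v = - (mu / `|1 + u * lam s|) * dot (T s) v ^+ 2.
Proof.
move=> Dm reg tv.
have Da := nbhs_singleton dalpha; have Dq := nbhs_singleton dq.
have := ruled_surface_regular Da Dq reg; set c := 1 + u * lam s => c0.
have DU : is_diff (s, u) (unit_normal F)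
    (Num.sg c *: ((fun h => h *: (mu *: T s)) \o (fst : R * R -> R))).
  apply: near_eq_is_diff (is_diffZ (Num.sg c) (is_diff_curve_fst u Dm)).
  by near=> p; apply/esym; near: p; exact: unit_normal_ruled.
have := getPex tv; rewrite /normal_curvature /weingarten.
move: (get _) => w wv.
have dU := congr1 (fun f : R * R -> 'rV[R]_3 => f w)
  (@diff_val _ _ _ _ _ _ _ DU).
have {}wv : w.1 *: (T s + u *: (lam s *: T s)) + w.2 *: q s = v.
  by rewrite -wv; exact/esym/diff_ruled_surface.
rewrite {}dU.
have Tv : dot (T s) v = w.1 * c.
  rewrite -wv !dot_linear (nbhs_singleton TT) (nbhs_singleton Tq) /c; ring.
have n0 : `|c| != 0 by rewrite normr_eq0.
rewrite !dot_linear Tv.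
have -> : Num.sg c * (w.1 * (mu * (w.1 * c))) = mu * w.1 ^+ 2 * (Num.sg c * c).
  by ring.
have c2 : c ^+ 2 = `|c| ^+ 2 by rewrite real_normK ?num_real.
rewrite -normrEsg exprMn c2; field.
exact: n0.
Unshelve. all: by end_near. Qed.

End TangentRuledSurface.

(** * Frenet curves *)

Section FrenetCurve.
Context {R : realType}.
Variables (I : set R) (alpha T N B : R -> 'rV[R]_3) (kappa tau : R -> R).
Hypothesis hIopen : open I.
Hypothesis hfrenet : frenet_curve I alpha T N B kappa tau.

Lemma near_domain t : I t -> \forall x \near t, I x.
Proof. by move=> It; exact: open_nbhs_nbhs. Qed.

Lemma frenet_frame t : I t ->
  [/\ [/\ dot (T t) (T t) = 1, dot (N t) (N t) = 1 & dot (B t) (B t) = 1],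
    [/\ dot (T t) (N t) = 0, dot (T t) (B t) = 0 & dot (N t) (B t) = 0],
    cross (T t) (N t) = B t & cross (T t) (B t) = - N t].
Proof.
move=> It.
exact: oriented_frame (frenet_orthonormal hfrenet It)
  (frenet_oriented hfrenet It).
Qed.

Lemma frenet_derive t : I t -> is_derive t 1 alpha (T t).
Proof.
move=> It; rewrite (frenet_tangent hfrenet It).
exact: is_derive_smooth (frenet_smooth hfrenet) It.
Qed.

(** Near [s] the curvature is [dot alpha'' N], and both factors are
    differentiable. *)
Lemma frenet_curvature_continuous s : I s -> {for s, continuous kappa}.
Proof.
move=> Is; have Inear := near_domain Is.
have E : \forall t \near s, kappa t = dot (derive1n 2 alpha t) (N t).
  near=> t; have It : I t by near: t.
  have [[_ NN _] _ _ _] := frenet_frame It.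
  have TE : \forall x \near t, T x = derive1 alpha x.
    apply: filterS (near_domain It) => x Ix.
    exact: (frenet_tangent hfrenet Ix).
  have := frenet_dT hfrenet It.
  move=> /(near_eq_is_derive TE) [_]; rewrite -derive1E => alpha2.
  rewrite [derive1n 2 alpha t]alpha2.
  by rewrite dot_linear NN mulr1.
have cont (f : R -> 'rV[R]_3) : derivable f s 1 -> f @ s --> f s.
  by move=> /derivable1_diffP/differentiable_continuous.
have d2alpha : derivable (derive1n 2 alpha) s 1.
  exact: (frenet_smooth hfrenet).
have dN : derivable N s 1 by have [] := frenet_dN hfrenet Is.
have := cvg_dot (cont _ d2alpha) (cont _ dN).
rewrite /prop_for /continuous_at (nbhs_singleton E).
move=> /(_ _); apply: cvg_trans; apply: near_eq_cvg; rewrite near_simpl.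
by apply: filterS E => t ->.
Unshelve. all: by end_near. Qed.

Lemma straight_line_curvature0 s : straight_line I alpha -> I s -> kappa s = 0.
Proof.
move=> [p [d lin]] Is.
have did (x : R) : is_derive x 1 (fun t : R => t *: d) d.
  by apply/is_derive_diff; exact: is_diff_scalel.
have dalpha x : I x -> is_derive x 1 alpha d.
  move=> Ix.
  have D := is_deriveD (is_derive_cst p x 1) (did x); rewrite add0r in D.
  apply: near_eq_is_derive D.
  by apply: filterS (near_domain Ix) => y Iy; rewrite lin.
have Td x : I x -> T x = d.
  move=> Ix; rewrite (frenet_tangent hfrenet Ix) derive1E.
  by have [_ ->] := dalpha x Ix.
have kN : kappa s *: N s = 0.
  have [_ <-] := frenet_dT hfrenet Is.
  have C : is_derive s 1 (cst d : R -> 'rV[R]_3) 0 by exact: is_derive_cst.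
  have [|_] := near_eq_is_derive (g := T) _ C; last by [].
  by apply: filterS (near_domain Is) => y Iy; rewrite Td.
have [[_ NN _] _ _ _] := frenet_frame Is.
by rewrite -[LHS]mulr1 -NN -dotZl kN /dot mul0mx mxE.
Qed.

(** * Developable generalized normal ruled surfaces *)

Variables (a1 a2 : R -> R).
Hypothesis ha1 : smooth_on I a1.
Hypothesis ha2 : smooth_on I a2.
Hypothesis ha : forall s, I s -> a1 s ^+ 2 + a2 s ^+ 2 = 1.
Let q := gnr_direction N B a1 a2.

Lemma dot_tangent_gnr t : I t -> dot (T t) (q t) = 0.
Proof.
move=> It; have [_ [TN TB _] _ _] := frenet_frame It.
by rewrite /q !dot_linear TN TB !mulr0 addr0.
Qed.

Lemma dot_gnr t : I t -> dot (q t) (q t) = 1.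
Proof.
move=> It; have [[_ NN BB] [_ _ NB] _ _] := frenet_frame It.
by rewrite /q !dot_linear NN BB (dotC (B t)) NB -[RHS](ha It); ring.
Qed.

Lemma cross_tangent_gnr t : I t ->
  cross (T t) (q t) = a1 t *: B t - a2 t *: N t.
Proof.
move=> It; have [_ _ cTN cTB] := frenet_frame It.
by rewrite crossDr !crossZr cTN cTB scalerN.
Qed.

Hypothesis hdev : developable I alpha q.

(** Two linear equations in [(a1', a2')]: the derivative of [a1^2 + a2^2 = 1]
    and developability, which reads [a1 a2' - a2 a1' + tau = 0].  The matrix of
    the system is a rotation. *)
Lemma gnr_derive_coeffs t : I t ->
  derive1 a1 t = a2 t * tau t /\ derive1 a2 t = - (a1 t * tau t).
Proof.
move=> It.
have D1 := is_derive_smooth ha1 It; have D2 := is_derive_smooth ha2 It.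
have orth : a1 t * derive1 a1 t + a2 t * derive1 a2 t = 0.
  have D : is_derive t 1 (a1 ^+ 2 + a2 ^+ 2) 0.
    have C : is_derive t 1 (cst 1 : R -> R) 0 by exact: is_derive_cst.
    apply: (near_eq_is_derive _ C); apply: filterS (near_domain It) => x Ix.
    by rewrite -[RHS]/(a1 x ^+ 2 + a2 x ^+ 2) ha.
  have [_ d1] := D.
  have [_ d2] := is_deriveD (is_deriveX 2 D1) (is_deriveX 2 D2).
  have H := etrans (esym d1) d2.
  rewrite /= !expr1 in H.
  apply: (@mulfI _ 2%:R); rewrite ?pnatr_eq0 // mulr0 H /GRing.scale /=; ring.
have [[_ NN BB] [TN TB NB] cTN cTB] := frenet_frame It.
have Dq : is_derive t 1 q _ :=
  is_deriveD (is_derive_scalef D1 (frenet_dN hfrenet It))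
             (is_derive_scalef D2 (frenet_dB hfrenet It)).
have dev : a1 t * derive1 a2 t - a2 t * derive1 a1 t + tau t = 0.
  have := hdev It; rewrite det_rows3 -(frenet_tangent hfrenet It) derive1E.
  have [_ ->] := Dq.
  rewrite crossDr !crossZr cTN cTB !dot_linear.
  rewrite (dotC (B t) (T t)) (dotC (B t) (N t)) (dotC (N t) (T t)).
  rewrite BB NN TN TB NB => /eqP.
  rewrite [X in X == 0](_ : _ = tau t * (a1 t ^+ 2 + a2 t ^+ 2) +
    (a1 t * derive1 a2 t - a2 t * derive1 a1 t)); last by ring.
  by rewrite ha // mulr1 => /eqP <-; ring.
split.
  rewrite -[LHS]mul1r -(ha It).
  have -> : (a1 t ^+ 2 + a2 t ^+ 2) * derive1 a1 t = a2 t * tau t +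
      a1 t * (a1 t * derive1 a1 t + a2 t * derive1 a2 t) -
      a2 t * (a1 t * derive1 a2 t - a2 t * derive1 a1 t + tau t) by ring.
  by rewrite orth dev !mulr0 subr0 addr0.
rewrite -[LHS]mul1r -(ha It).
have -> : (a1 t ^+ 2 + a2 t ^+ 2) * derive1 a2 t = - (a1 t * tau t) +
    a2 t * (a1 t * derive1 a1 t + a2 t * derive1 a2 t) +
    a1 t * (a1 t * derive1 a2 t - a2 t * derive1 a1 t + tau t) by ring.
by rewrite orth dev !mulr0 !addr0.
Qed.

Lemma gnr_derive t : I t -> is_derive t 1 q ((- (kappa t * a1 t)) *: T t).
Proof.
move=> It; have [e1 e2] := gnr_derive_coeffs It.
have D1 := is_derive_smooth ha1 It; have D2 := is_derive_smooth ha2 It.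
apply: is_derive_eq.
  exact: is_deriveD (is_derive_scalef D1 (frenet_dN hfrenet It))
                    (is_derive_scalef D2 (frenet_dB hfrenet It)).
by rewrite e1 e2; apply: row3P; rewrite !mxE; ring.
Qed.

Lemma gnr_normal_derive t : I t ->
  is_derive t 1 (fun x => cross (T x) (q x)) ((kappa t * a2 t) *: T t).
Proof.
move=> It; have [e1 e2] := gnr_derive_coeffs It.
have D1 := is_derive_smooth ha1 It; have D2 := is_derive_smooth ha2 It.
have D := is_deriveB (is_derive_scalef D1 (frenet_dB hfrenet It))
                     (is_derive_scalef D2 (frenet_dN hfrenet It)).
apply: (near_eq_is_derive _ (is_derive_eq D _)).
  apply: filterS (near_domain It) => x Ix.
  by rewrite cross_tangent_gnr.
by rewrite e1 e2; apply: row3P; rewrite !mxE; ring.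
Qed.

Lemma gnr_regular s u :
  I s -> regular_point (ruled_surface alpha q) (s, u) ->
  1 - u * (kappa s * a1 s) != 0.
Proof.
move=> Is reg; rewrite -mulrN.
exact: ruled_surface_regular (frenet_derive Is) (gnr_derive Is) reg.
Qed.

Lemma gnr_tangent_vector s u v :
  I s -> tangent_vector (ruled_surface alpha q) (s, u) v ->
  exists y, v = dot (T s) v *: T s + y *: q s.
Proof.
move=> Is [w wv].
have {}wv : w.1 *: (T s + u *: ((- (kappa s * a1 s)) *: T s)) + w.2 *: q s = v.
  rewrite -wv; apply/esym.
  exact: diff_ruled_surface (frenet_derive Is) (gnr_derive Is) w.
have [[TT _ _] _ _ _] := frenet_frame Is.
exists w.2; rewrite -{}wv; congr (_ + _).
move: (q s) (dot_tangent_gnr Is) => qs Tq.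
rewrite !dot_linear TT Tq.
by apply: row3P; rewrite !mxE; ring.
Qed.

Lemma gnr_normal_curvature s u v (F := ruled_surface alpha q) :
  I s -> regular_point F (s, u) -> tangent_vector F (s, u) v ->
  normal_curvature F (s, u) v =
    - (kappa s * a2 s / `|1 - u * (kappa s * a1 s)|) * dot (T s) v ^+ 2.
Proof.
move=> Is reg tv; have Inear := near_domain Is.
have a1c : {for s, continuous a1}.
  have [d1 _] := is_derive_smooth ha1 Is.
  by apply: differentiable_continuous; exact/derivable1_diffP.
have dalpha : \forall x \near s, is_derive (x : R) 1 alpha (T x).
  by apply: filterS Inear => x; exact: frenet_derive.
have dq : \forall x \near s,
    is_derive (x : R) 1 q (- (kappa x * a1 x) *: T x).
  by apply: filterS Inear => x; exact: gnr_derive.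
have TT : \forall x \near s, dot (T x) (T x) = 1.
  by apply: filterS Inear => x /frenet_frame[[]].
have qq : \forall x \near s, dot (q x) (q x) = 1.
  by apply: filterS Inear => x; exact: dot_gnr.
have Tq : \forall x \near s, dot (T x) (q x) = 0.
  by apply: filterS Inear => x; exact: dot_tangent_gnr.
have lamc : {for s, continuous (fun x => - (kappa x * a1 x))}.
  by apply: cvgN; apply: cvgM => //; exact: frenet_curvature_continuous.
rewrite (normal_curvature_ruled dalpha dq TT qq Tq lamc
  (gnr_normal_derive Is) reg tv).
by rewrite mulrN.
Qed.

End FrenetCurve.

Theorem theorem3p18 (R : realType) (I : set R)
    (hIopen : open I) (hIitv : is_interval I)
    (alpha T N B : R -> 'rV[R]_3) (kappa tau : R -> R)
    (hfrenet : frenet_curve I alpha T N B kappa tau)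
    (a1 a2 : R -> R) (ha1 : smooth_on I a1) (ha2 : smooth_on I a2)
    (ha : forall s, I s -> a1 s ^+ 2 + a2 s ^+ 2 = 1)
    (hdev : developable I alpha (gnr_direction N B a1 a2)) :
  let q := gnr_direction N B a1 a2 in
  let F := ruled_surface alpha q in
  forall (s u : R) (v : 'rV[R]_3),
    I s -> regular_point F (s, u) ->
    tangent_vector F (s, u) v -> enorm v = 1 ->
    ((forall t, I t -> kappa t != 0) ->
       (asymptotic F (s, u) v <-> (v = q s \/ v = - q s) \/ a2 s = 0)) /\
    (straight_line I alpha -> asymptotic F (s, u) v).
Proof.
move=> q F s u v Is reg tv v1.
have kn := gnr_normal_curvature hIopen hfrenet ha1 ha2 ha hdev Is reg tv.
rewrite /asymptotic kn; split=> [k0|line]; last first.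
  rewrite (straight_line_curvature0 hIopen hfrenet line Is).
  by rewrite !mul0r oppr0 mul0r.
have Tq : dot (T s) (q s) = 0 by exact: dot_tangent_gnr hfrenet _ _ _ Is.
split=> [/eqP|[vq|->]]; last first.
- by rewrite mulr0 mul0r oppr0 mul0r.
- suff -> : dot (T s) v = 0 by rewrite expr0n mulr0.
  by case: vq => ->; rewrite -1?scaleN1r ?dotZr Tq ?mulr0.
have c0 := gnr_regular hIopen hfrenet ha1 ha2 ha hdev Is reg.
rewrite mulf_eq0 oppr_eq0 !mulf_eq0 invr_eq0 normr_eq0 (negPf c0) orbF.
rewrite (negPf (k0 s Is)) /= orbb => /orP[/eqP->|/eqP Tv]; first by right.
left; have [y vE] := gnr_tangent_vector hIopen hfrenet ha1 ha2 ha hdev Is tv.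
move: vE; rewrite Tv scale0r add0r => vE.
have nq : enorm (gnr_direction N B a1 a2 s) = 1.
  by rewrite /enorm (dot_gnr hfrenet ha Is) sqrtr1.
move: v1; rewrite vE enormZ nq mulr1 => /eqP.
rewrite eqr_norml ler01 andbT => /orP[]/eqP ->.
- by left; rewrite scale1r.
- by right; rewrite scaleN1r.
Qed.
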